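(* Let $d\ge 2$ and let $\mathcal{S}$ be the family of all compact spindle starshaped sets in $\mathbb{E}^d$, equipped with the Hausdorff distance. Then the set of those $S\in\mathcal{S}$ whose spindle kernel $\ker_{\mathrm{s}} S$ is not a singleton is of first category in $\mathcal{S}$ (i.e. is a countable union of nowhere dense subsets of $\mathcal{S}$); that is, the spindle kernel of a typical compact spindle starshaped set is a singleton.
   Context: For $x,y\in\mathbb{E}^d$ the spindle $[x,y]_{\mathrm{s}}$ is the intersection of all closed unit balls containing $x$ and $y$ if $|x-y|\le2$, and $\mathbb{E}^d$ otherwise. For $A\subseteq\mathbb{E}^d$, $p\in A$: $\operatorname{st}_{\mathrm{s}}(p,A)=\{q\in A:[p,q]_{\mathrm{s}}\subseteq A\}$; $\ker_{\mathrm{s}}A=\{p\in A:\operatorname{st}_{\mathrm{s}}(p,A)=A\}$; $A$ is spindle starshaped if $\ker_{\mathrm{s}}A\neq\emptyset$. *)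

(* Defs.v *)
From HB Require Import structures.
From mathcomp Require Import all_boot all_order all_algebra.
From mathcomp Require Import all_classical all_reals all_analysis matrix_topology.
Import numFieldNormedType.Exports.
Set Implicit Arguments. Unset Strict Implicit. Unset Printing Implicit Defensive.
Import Order.TTheory GRing.Theory Num.Theory.
Local Open Scope classical_set_scope.
Local Open Scope ring_scope.

(* Euclidean space E^d is modelled as 'rV[R]_d (with its standard product
   topology, which is the Euclidean topology); the Euclidean distance is
   defined explicitly. *)

Definition edist (R : realType) (d : nat) (x y : 'rV[R]_d) : R :=
  Num.sqrt (\sum_(i < d) (x 0 i - y 0 i) ^+ 2).

Definition cball1 (R : realType) (d : nat) (c : 'rV[R]_d) : set 'rV[R]_d :=
  [set z | edist z c <= 1].

Definition spindle (R : realType) (d : nat) (x y : 'rV[R]_d) : set 'rV[R]_d :=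
  if edist x y <= 2 then
    [set z | forall c : 'rV[R]_d, cball1 c x -> cball1 c y -> cball1 c z]
  else setT.

Definition spindle_star (R : realType) (d : nat) (p : 'rV[R]_d)
  (A : set 'rV[R]_d) : set 'rV[R]_d :=
  [set q | A q /\ spindle p q `<=` A].

Definition spindle_kernel (R : realType) (d : nat) (A : set 'rV[R]_d)
  : set 'rV[R]_d :=
  [set p | A p /\ spindle_star p A = A].

Definition spindle_starshaped (R : realType) (d : nat) (A : set 'rV[R]_d)
  : Prop := spindle_kernel A !=set0.

Definition eneigh (R : realType) (d : nat) (B : set 'rV[R]_d) (e : R)
  : set 'rV[R]_d :=
  [set x | exists2 b, B b & edist x b <= e].

Definition hausdorff (R : realType) (d : nat) (A B : set 'rV[R]_d) : R :=
  inf [set e : R | 0 <= e /\ A `<=` eneigh B e /\ B `<=` eneigh A e].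

Definition cSS (R : realType) (d : nat) : set (set 'rV[R]_d) :=
  [set S : set 'rV[R]_d | compact S /\ spindle_starshaped S].

Definition hclosure (R : realType) (d : nat) (F N : set (set 'rV[R]_d))
  : set (set 'rV[R]_d) :=
  [set S | F S /\ forall r : R, 0 < r -> exists2 T, N T & hausdorff S T < r].

Definition hinterior (R : realType) (d : nat) (F X : set (set 'rV[R]_d))
  : set (set 'rV[R]_d) :=
  [set S | X S /\ exists2 r : R, 0 < r &
     forall T, F T -> hausdorff S T < r -> X T].

Definition nowhere_dense_in (R : realType) (d : nat) (F N : set (set 'rV[R]_d))
  : Prop := N `<=` F /\ hinterior F (hclosure F N) = set0.

Definition first_category_in (R : realType) (d : nat) (F X : set (set 'rV[R]_d))
  : Prop :=
  exists N : nat -> set (set 'rV[R]_d),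
    (forall n, nowhere_dense_in F (N n)) /\ X = \bigcup_n N n.

(* Main.v *)
(* The sets whose kernel contains two points at distance at least 1/(n+1) exhaust the
   exceptional family, so it suffices to find, arbitrarily close to a given S with kernel
   point p, a set T such that kernel points of sets converging to T can only accumulate
   within a small distance of p.

   Such a T is obtained by attaching tips. If x is not in a compact set A, then, when d >= 2,
   a point q whose spindle with x stays in the union of A and the spindle [p,x] must itself
   lie in [p,x]: otherwise [q,x] leaves [p,x] arbitrarily close to x. The points witnessing
   this are interior to [q,x], so the conclusion persists for limits of kernel points.
   If some x close to p is missing from S, attach [p,x] to S. Otherwise p is interior to S;
   shrink S slightly towards p and attach [p,x] and [p,y] for points x, y of S in opposite
   directions from p, outside the shrunk copy: [p,x] and [p,y] meet only at p. *)
Require Import Defs.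
From HB Require Import structures.
From mathcomp Require Import all_boot all_order all_algebra.
From mathcomp Require Import all_classical all_reals all_analysis matrix_topology.
From mathcomp Require Import ring lra.
Import numFieldNormedType.Exports.
(* Restores the Euclidean [edist], shadowed by the extended distance of MathComp-Analysis *)
Import Defs.
Import Order.TTheory GRing.Theory Num.Theory.
Local Open Scope classical_set_scope.
Local Open Scope ring_scope.
Set Implicit Arguments.
Unset Strict Implicit.
Unset Printing Implicit Defensive.

(** * Inner product, Euclidean norm and the topology they induce *)

Section Euclid.
Variables (R : realType) (d : nat).
Implicit Types (u v w x y z c p q : 'rV[R]_d) (a t r : R).

Definition dot u v : R := \sum_(i < d) u 0 i * v 0 i.

Lemma dotC u v : dot u v = dot v u.
Proof. by apply: eq_bigr => i _; rewrite mulrC. Qed.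

Lemma dotDl u v w : dot (u + v) w = dot u w + dot v w.
Proof. by rewrite -big_split; apply: eq_bigr => i _; rewrite !mxE mulrDl. Qed.

Lemma dotZl a u v : dot (a *: u) v = a * dot u v.
Proof. by rewrite mulr_sumr; apply: eq_bigr => i _; rewrite !mxE mulrA. Qed.

Lemma dotNl u v : dot (- u) v = - dot u v.
Proof. by rewrite -scaleN1r dotZl mulN1r. Qed.

Lemma dotDr u v w : dot w (u + v) = dot w u + dot w v.
Proof. by rewrite dotC dotDl !(dotC w). Qed.

Lemma dotZr a u v : dot u (a *: v) = a * dot u v.
Proof. by rewrite dotC dotZl dotC. Qed.

Lemma dotNr u v : dot u (- v) = - dot u v.
Proof. by rewrite dotC dotNl dotC. Qed.

Definition dotE := (dotDl, dotDr, dotNl, dotNr, dotZl, dotZr).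

Lemma dot_ge0 v : 0 <= dot v v.
Proof. by apply: sumr_ge0 => i _; rewrite -expr2 sqr_ge0. Qed.

Lemma dot_eq0 v : dot v v = 0 -> v = 0.
Proof.
move=> /eqP; rewrite psumr_eq0 => [/allP h|i _]; last by rewrite -expr2 sqr_ge0.
apply/rowP => i; have /= := h i (mem_index_enum _).
by rewrite mulf_eq0 orbb mxE => /eqP.
Qed.

Lemma dot_gt0 v : v != 0 -> 0 < dot v v.
Proof.
by move=> v0; rewrite lt_def dot_ge0 andbT; apply: contraNneq v0 => /dot_eq0 ->.
Qed.

Lemma dot0r v : dot v 0 = 0.
Proof. by rewrite -(scale0r 0) dotZr mul0r. Qed.

Lemma cauchy_schwarz u v : dot u v ^+ 2 <= dot u u * dot v v.
Proof.
have [->|v0] := eqVneq v 0; first by rewrite !dot0r expr0n mulr0.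
(* The squared norm of this vector is [dot v v] times the difference to be shown nonnegative. *)
have := dot_ge0 (dot v v *: u - dot u v *: v); have := dot_gt0 v0.
rewrite !dotE (dotC v u) => vv h.
rewrite -subr_ge0 -(pmulr_rge0 _ vv); apply: le_trans h _.
by rewrite le_eqVlt; apply/orP; left; apply/eqP; ring.
Qed.

Definition enorm v : R := Num.sqrt (dot v v).

Lemma edistE x y : edist x y = enorm (x - y).
Proof.
rewrite /edist /enorm; congr Num.sqrt.
by apply: eq_bigr => i _; rewrite !mxE expr2.
Qed.

Lemma enorm_ge0 v : 0 <= enorm v. Proof. exact: sqrtr_ge0. Qed.

Lemma enorm_sqr v : enorm v ^+ 2 = dot v v.
Proof. by rewrite sqr_sqrtr ?dot_ge0. Qed.

Lemma enorm_le v r : 0 <= r -> (enorm v <= r) = (dot v v <= r ^+ 2).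
Proof. by move=> r0; rewrite -enorm_sqr ler_pXn2r // nnegrE enorm_ge0. Qed.

Lemma dot_le_enorm u v : dot u v <= enorm u * enorm v.
Proof.
apply: le_trans (ler_norm _) _.
rewrite -(@ler_pXn2r _ 2) ?nnegrE ?mulr_ge0 ?enorm_ge0 //.
by rewrite exprMn !enorm_sqr real_normK ?num_real// cauchy_schwarz.
Qed.

Lemma enormD u v : enorm (u + v) <= enorm u + enorm v.
Proof.
rewrite enorm_le ?addr_ge0 ?enorm_ge0 // !dotE (dotC v u).
have := dot_le_enorm u v; have := enorm_sqr u; have := enorm_sqr v.
by move=> <- <-; nra.
Qed.

Lemma enormZ a v : enorm (a *: v) = `|a| * enorm v.
Proof.
by rewrite /enorm dotZl dotZr mulrA -expr2 sqrtrM ?sqr_ge0 // sqrtr_sqr.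
Qed.

Lemma enormN v : enorm (- v) = enorm v.
Proof. by rewrite /enorm dotNl dotNr opprK. Qed.

Lemma enorm0_eq0 v : enorm v = 0 -> v = 0.
Proof. by move=> h; apply: dot_eq0; rewrite -enorm_sqr h expr0n. Qed.

Lemma enorm0 : enorm 0 = 0.
Proof. by rewrite /enorm dot0r sqrtr0. Qed.

Lemma edistC x y : edist x y = edist y x.
Proof. by rewrite !edistE -enormN opprB. Qed.

Lemma edist_tri x y z : edist x z <= edist x y + edist y z.
Proof. by rewrite !edistE; apply: le_trans (enormD _ _); rewrite addrA subrK. Qed.

Lemma edist_ge0 x y : 0 <= edist x y.
Proof. by rewrite edistE enorm_ge0. Qed.

Lemma edistxx x : edist x x = 0.
Proof. by rewrite edistE subrr enorm0. Qed.

Lemma edist_gt0 x y : x != y -> 0 < edist x y.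
Proof.
rewrite lt_def edist_ge0 andbT edistE; apply: contra_neq => /enorm0_eq0/eqP.
by rewrite subr_eq0 => /eqP.
Qed.

Lemma cvg_dot (T : topologicalType) (f g : T -> 'rV[R]_d) (x : T) u v :
  f t @[t --> x] --> u -> g t @[t --> x] --> v ->
  dot (f t) (g t) @[t --> x] --> dot u v.
Proof.
move=> cf cg; rewrite /dot.
apply: cvg_big => [|i _]; first exact: add_continuous.
apply: cvgM.
  exact: (cvg_comp f (fun M : 'rV[R]_d => M 0 i) cf (@coord_continuous R 1 d 0 i u)).
exact: (cvg_comp g (fun M : 'rV[R]_d => M 0 i) cg (@coord_continuous R 1 d 0 i v)).
Qed.

Lemma edist_continuous x : continuous (edist x).
Proof.
move=> y; rewrite (_ : edist x = fun z => Num.sqrt (dot (x - z) (x - z))); last first.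
  by apply/funext => z; rewrite edistE.
have c : (x - z) @[z --> y] --> x - y.
  exact: (@cvgB R _ _ (nbhs y) _ (fun=> x) id x y (cvg_cst x) cvg_id).
apply: (cvg_comp (fun z => dot (x - z) (x - z)) Num.sqrt (cvg_dot c c)).
exact: sqrt_continuous.
Qed.

Lemma norm_le_enorm v : `|v| <= enorm v.
Proof.
rewrite /Num.norm /= mx_normrE; apply/bigmax_leP; split; first exact: enorm_ge0.
case=> i j _ /=; rewrite (ord1 i) -(@ler_pXn2r _ 2) ?nnegrE ?enorm_ge0 //.
rewrite enorm_sqr real_normK ?num_real // /dot (bigD1 j) //= -expr2 lerDl.
by apply: sumr_ge0 => k _; rewrite -expr2 sqr_ge0.
Qed.

(** The sup norm behind the topology is at most the Euclidean norm, and conversely [edist x] is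
    continuous, so topological notions can be handled through [edist]. *)
Lemma nbhs_edist x (U : set 'rV[R]_d) :
  nbhs x U <-> exists2 e : R, 0 < e & forall y, edist x y < e -> U y.
Proof.
split.
  move=> /nbhs_ballP[e /= e0 h]; exists e => // y xy; apply: h.
  rewrite -ball_normE /ball_ /=; apply: le_lt_trans xy.
  by rewrite edistE norm_le_enorm.
move=> [e e0 h].
have : nbhs x (edist x @^-1` [set t | t < e]).
  by apply: (@edist_continuous x x); rewrite edistxx; exact: lt_nbhsl.
exact: filterS.
Qed.

Lemma closed_edist (A : set 'rV[R]_d) : closed A <->
  forall x, (forall e : R, 0 < e -> exists2 y, A y & edist x y < e) -> A x.
Proof.
split=> [cA x h|h x cx].
  apply: cA => U /nbhs_edist[e e0 hU]; have [y Ay xy] := h _ e0.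
  by exists y; split => //; apply: hU.
apply: h => e e0.
have [|y [Ay xy]] := cx [set y | edist x y < e]; last by exists y.
by apply/nbhs_edist; exists e.
Qed.

Lemma compact_edist_bounded (A : set 'rV[R]_d) p : compact A ->
  exists2 M : R, 0 < M & forall x, A x -> edist p x <= M.
Proof.
move=> cA.
have : compact (edist p @` A).
  apply: continuous_compact => //; apply: continuous_subspaceT; exact: edist_continuous.
move=> /compact_bounded [M [_ /(_ (`|M| + 1))]] h; exists (`|M| + 1).
  by rewrite ltr_wpDl.
have M1 : M < `|M| + 1 by rewrite (le_lt_trans (ler_norm _)) // ltrDl.
move=> x Ax; rewrite -[edist p x]ger0_norm ?edist_ge0 //.
by apply: (h M1); exists x.
Qed.

Lemma bounded_closed_edist_compact (A : set 'rV[R]_d) p r : closed A ->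
  (forall x, A x -> edist p x <= r) -> compact A.
Proof.
move=> cA bA; apply: bounded_closed_compact => //.
exists (`|p| + r); split; first exact: num_real.
move=> M /ltW hM x Ax; apply: le_trans hM.
rewrite -[x](subrKC p); apply: le_trans (ler_normD _ _) _.
rewrite lerD2l; apply: le_trans (norm_le_enorm _) _.
by rewrite -edistE edistC; exact: bA.
Qed.

End Euclid.

(** * Spindles in coordinates along and across their axis *)

Section Spindle.
Variables (R : realType) (d : nat).
Implicit Types (e m u v w x y z c p q : 'rV[R]_d) (a t r l h : R).

Lemma dot_delta i v : dot (delta_mx 0 i) v = v 0 i.
Proof.
rewrite /dot (bigD1 i) //= big1 => [|j ji]; rewrite !mxE eqxx /= ?eqxx ?mul1r ?addr0 //.
by rewrite (negbTE ji) mul0r.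
Qed.

Lemma exists_unit v : v != 0 -> exists2 s : R, 0 < s & dot (s *: v) (s *: v) = 1.
Proof.
move=> /dot_gt0 v0; exists (enorm v)^-1; first by rewrite invr_gt0 sqrtr_gt0.
by rewrite !dotE mulrA -enorm_sqr -expr2 -exprMn mulVf ?expr1n // gt_eqF // sqrtr_gt0.
Qed.

Lemma exists_perp_unit (hd : (2 <= d)%N) e : e != 0 ->
  exists2 w, dot w w = 1 & dot w e = 0.
Proof.
move=> e0.
have [i ei] : exists i, e 0 i != 0.
  apply/existsP; apply: contra_neqT e0; rewrite negb_exists => /forallP h.
  by apply/rowP => i; rewrite mxE; apply/eqP; rewrite -[_ == _]negbK h.
have [j ji] : exists j : 'I_d, j != i.
  case: d hd i {e e0 ei} => [//|[//|n]] _ i.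
  exists (if i == ord0 then lift ord0 ord0 else ord0).
  by case: (eqVneq i ord0) => [->//|]; rewrite eq_sym.
(* A quarter turn of the projection of [e] to the plane of coordinates [i] and [j], nonzero by the
   choice of [i]. *)
pose w : 'rV[R]_d := - e 0 j *: delta_mx 0 i + e 0 i *: delta_mx 0 j.
have w0 : w != 0.
  apply: contra_neq ei => /rowP/(_ j); rewrite !mxE eqxx /= (negbTE ji) eqxx.
  by rewrite mulr0 mulr1 add0r.
have [s s0 ws] := exists_unit w0; exists (s *: w) => //.
rewrite dotZl /w !dotE !dot_delta; ring.
Qed.

(** Here [a], [al] are the axial coordinates of a point v and a centre c, [b], [be] their distances
    from the axis, and [w] is the inner product of their parts orthogonal to it. The conditions on c
    amount to al^2 + be^2 + 2 l |al| <= h^2, whence be <= h; combine with |a| <= l and -w <= b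
    be. *)
Lemma spindle_frame_real (a b al be w h l : R) :
  0 <= b -> 0 <= be -> 0 <= h -> 0 <= l -> l ^+ 2 + h ^+ 2 = 1 ->
  w ^+ 2 <= (b * be) ^+ 2 -> a ^+ 2 + b ^+ 2 + 2 * h * b <= l ^+ 2 ->
  (al - l) ^+ 2 + be ^+ 2 <= 1 -> (al + l) ^+ 2 + be ^+ 2 <= 1 ->
  a ^+ 2 + b ^+ 2 - 2 * (a * al + w) + al ^+ 2 + be ^+ 2 <= 1.
Proof.
move=> b0 be0 h0 l0 lh hw hz hm hp.
have w1 : - w <= b * be.
  have : `|w| <= b * be.
    by rewrite -(@ler_pXn2r _ 2) ?nnegrE ?mulr_ge0 // real_normK // num_real.
  by apply: le_trans; rewrite -normrN ler_norm.
have [al1 al2] : al ^+ 2 + be ^+ 2 + 2 * l * `|al| <= h ^+ 2 /\ - (a * al) <= l * `|al|.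
  have [a1 a2] : a <= l /\ - l <= a.
    have : `|a| <= l.
      rewrite -(@ler_pXn2r _ 2) ?nnegrE // real_normK ?num_real //.
      have : 0 <= h * b by exact: mulr_ge0.
      by nra.
    by rewrite ler_norml => /andP[].
  case: (ger0P al) => al0; split; nra.
have beh : be <= h.
  rewrite -(@ler_pXn2r _ 2) ?nnegrE //.
  have : 0 <= l * `|al| by exact: mulr_ge0.
  by nra.
have : 0 <= b * (h - be) by rewrite mulr_ge0 // subr_ge0.
by nra.
Qed.

Lemma dot_perp e u v : dot e e = 1 ->
  dot (u - dot u e *: e) (v - dot v e *: e) = dot u v - dot u e * dot v e.
Proof. by move=> e1; rewrite !dotE e1 (dotC e v); ring. Qed.

Lemma dot_sub u v : dot (u - v) (u - v) = dot u u - 2 * dot u v + dot v v.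
Proof. by rewrite !dotE (dotC v u); ring. Qed.

(* For a unit vector e and l ^+ 2 + h ^+ 2 = 1, the spindle of -l *: e and l *: e is the
   set of all v with bulge h e v <= l ^+ 2. *)
Definition bulge h e v := dot v v + 2 * h * enorm (v - dot v e *: e).

(** Here [c] is the centre of a unit ball containing [- l *: e] and [l *: e]. Splitting [v] and [c]
    along [e] leaves [spindle_frame_real]. *)
Lemma bulge_le h l e v c : dot e e = 1 -> 0 <= h -> 0 <= l -> l ^+ 2 + h ^+ 2 = 1 ->
  bulge h e v <= l ^+ 2 ->
  dot (c - l *: e) (c - l *: e) <= 1 -> dot (c + l *: e) (c + l *: e) <= 1 ->
  dot (v - c) (v - c) <= 1.
Proof.
move=> e1 h0 l0 lh; rewrite /bulge.
set vp := v - dot v e *: e => hv; pose cp := c - dot c e *: e.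
have vv : dot v v = dot v e ^+ 2 + enorm vp ^+ 2.
  by rewrite enorm_sqr /vp (dot_perp _ _ e1) expr2 addrC subrK.
have cc : dot c c = dot c e ^+ 2 + enorm cp ^+ 2.
  by rewrite enorm_sqr /cp (dot_perp _ _ e1) expr2 addrC subrK.
have vc : dot v c = dot v e * dot c e + dot vp cp.
  by rewrite /vp /cp (dot_perp _ _ e1) addrC subrK.
have cs : dot vp cp ^+ 2 <= (enorm vp * enorm cp) ^+ 2.
  by rewrite exprMn !enorm_sqr cauchy_schwarz.
move=> hm hp.
rewrite dot_sub vv vc cc addrA.
apply: (@spindle_frame_real _ _ _ _ _ h l) => //; rewrite ?enorm_ge0 //.
- by move: hv; rewrite vv.
- by move: hm; rewrite dot_sub cc !dotE e1; nra.
- by move: hp; rewrite !dotE (dotC e) e1 cc; nra.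
Qed.
(** Take c = -h w with w the unit vector along the part of [v] orthogonal to [e], or any unit normal
    to [e] if that part vanishes. Then |v - c|^2 = bulge + h^2 > l^2 + h^2 = 1. *)
Lemma bulge_gt (hd : (2 <= d)%N) h l e v : dot e e = 1 -> l ^+ 2 + h ^+ 2 = 1 ->
  l ^+ 2 < bulge h e v ->
  exists c, [/\ dot (c - l *: e) (c - l *: e) = 1,
    dot (c + l *: e) (c + l *: e) = 1 & 1 < dot (v - c) (v - c)].
Proof.
move=> e1 lh; rewrite /bulge; set vp := v - dot v e *: e => hv.
have [w [w1 we wv]] : exists w, [/\ dot w w = 1, dot w e = 0 & dot v w = enorm vp].
  have [vp0|/exists_unit[s s0 ws]] := eqVneq vp 0.
    have [|w w1 we] := @exists_perp_unit hd e.
      by apply: contra_eq_neq e1 => ->; rewrite dot0r eq_sym oner_eq0.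
    exists w; split => //; rewrite vp0 enorm0.
    by move/eqP: vp0; rewrite subr_eq0 => /eqP ->; rewrite dotZl (dotC e w) we mulr0.
  have vpe : dot vp e = 0 by rewrite /vp !dotE e1 mulr1 subrr.
  exists (s *: vp); split; [by []|by rewrite dotZl vpe mulr0|].
  have vvp : dot v vp = dot vp vp.
    by rewrite {2}/vp dotDl dotNl dotZl (dotC e) vpe mulr0 subr0.
  have e0 := enorm_ge0 vp.
  have : s * enorm vp = 1.
    by rewrite -[s]ger0_norm 1?ltW // -enormZ /enorm ws sqrtr1.
  by rewrite dotZr vvp -enorm_sqr expr2 mulrA => ->; rewrite mul1r.
exists (- h *: w); split; last first.
- rewrite dot_sub !dotE w1 wv; nra.
- rewrite !dotE w1 we (dotC e) we e1; nra.
- rewrite !dotE w1 we (dotC e) we e1; nra.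
Qed.

End Spindle.

Local Ltac vring := apply/rowP => i; rewrite !mxE; ring.

(** * Spindles of arbitrary pairs of points *)

Section SpindleSets.
Variables (R : realType) (d : nat).
Implicit Types (e m u v w x y z c p q : 'rV[R]_d) (a t r l h : R).

Lemma spindleE p x : edist p x <= 2 -> spindle p x =
  [set z | forall c, edist p c <= 1 -> edist x c <= 1 -> edist z c <= 1].
Proof. by rewrite /spindle => ->. Qed.

Lemma edist_le x y r : 0 <= r -> (edist x y <= r) = (dot (x - y) (x - y) <= r ^+ 2).
Proof. by move=> r0; rewrite edistE enorm_le. Qed.

Lemma edist_le1 x y : (edist x y <= 1) = (dot (x - y) (x - y) <= 1).
Proof. by rewrite edist_le // expr1n. Qed.

Lemma dotNN v : dot (- v) (- v) = dot v v.
Proof. by rewrite dotNl dotNr opprK. Qed.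

Definition mid p x : 'rV[R]_d := 2^-1 *: (p + x).

Lemma edist_midl p x : edist p (mid p x) = edist p x / 2.
Proof.
rewrite !edistE -[RHS]mulrC -[X in X * _]ger0_norm // -enormZ; congr enorm.
by apply/rowP => i; rewrite !mxE; field.
Qed.

Lemma edist_midr p x : edist x (mid p x) = edist p x / 2.
Proof. by rewrite /mid addrC edist_midl edistC. Qed.

(** Normal position about the midpoint: [h] is the distance from it to the centre of any unit sphere
    through [p] and [x]. *)
Lemma spindle_frame p x : p != x -> edist p x <= 2 -> exists e l h,
  [/\ dot e e = 1, 0 < l, 0 <= h, l ^+ 2 + h ^+ 2 = 1 &
      p = mid p x - l *: e /\ x = mid p x + l *: e].
Proof.
move=> px px2; have px0 := edist_gt0 px; set D := edist p x in px2 px0.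
exists (D^-1 *: (x - p)), (D / 2), (Num.sqrt (1 - (D / 2) ^+ 2)).
have Dn0 : D != 0 by rewrite gt_eqF.
split.
- rewrite dotZl dotZr -enorm_sqr -edistE (edistC x) -/D.
  by field.
- by rewrite divr_gt0.
- exact: sqrtr_ge0.
- by rewrite sqr_sqrtr ?subrKC // subr_ge0 exprn_ile1 //; lra.
by split; apply/rowP => i; rewrite !mxE; field.
Qed.

Lemma spindle_bulge p x e l h z : p = mid p x - l *: e -> x = mid p x + l *: e ->
  edist p x <= 2 -> dot e e = 1 -> 0 <= l -> 0 <= h -> l ^+ 2 + h ^+ 2 = 1 ->
  bulge h e (z - mid p x) <= l ^+ 2 -> spindle p x z.
Proof.
set m := mid p x => hp hx px2 e1 l0 h0 lh hb; rewrite spindleE // => c.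
rewrite !edist_le1 => pc xc; rewrite -[z](subrK m).
rewrite (_ : z - m + m - c = (z - m) - (c - m)); last first.
  by apply/rowP => i; rewrite !mxE; ring.
apply: (bulge_le e1 h0 l0 lh hb).
  rewrite (_ : c - m - l *: e = - (x - c)) ?dotNN //.
  by rewrite {1}hx; vring.
rewrite (_ : c - m + l *: e = - (p - c)) ?dotNN //.
by rewrite {1}hp; vring.
Qed.

Lemma spindle_out_bulge (hd : (2 <= d)%N) p x e l h z :
  p = mid p x - l *: e -> x = mid p x + l *: e ->
  dot e e = 1 -> l ^+ 2 + h ^+ 2 = 1 ->
  l ^+ 2 < bulge h e (z - mid p x) ->
  exists c, [/\ edist p c = 1, edist x c = 1 & 1 < edist z c].
Proof.
set m := mid p x => hp hx e1 lh /(bulge_gt hd e1 lh)[c [c1 c2 c3]].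
exists (m + c); split.
- rewrite edistE (_ : p - (m + c) = - (c + l *: e)) ?enormN /enorm ?c2 ?sqrtr1 //.
  by rewrite {1}hp; vring.
- rewrite edistE (_ : x - (m + c) = - (c - l *: e)) ?enormN /enorm ?c1 ?sqrtr1 //.
  by rewrite {1}hx; vring.
by rewrite edistE (_ : z - (m + c) = z - m - c) ?ltNge ?enorm_le ?expr1n -?ltNge //; vring.
Qed.

(** The definition only gives a unit ball containing [p] and [x]. Passing through [bulge] puts both
    on its boundary, which the tip argument needs for [x]. *)
Lemma spindle_out (hd : (2 <= d)%N) p x z : p != x -> edist p x <= 2 ->
  ~ spindle p x z ->
  exists c, [/\ edist p c = 1, edist x c = 1 & 1 < edist z c].
Proof.
move=> px px2 nz; have [e [l [h [e1 l0 h0 lh [hp hx]]]]] := spindle_frame px px2.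
apply: (spindle_out_bulge hd hp hx e1 lh); rewrite ltNge; apply/negP => hb.
by apply: nz; apply: (spindle_bulge hp hx px2 e1 (ltW l0) h0 lh hb).
Qed.

(** Since [bulge] dominates the squared norm, the spindle lies in the ball having p and x as ends of
    a diameter. *)
Lemma spindle_edist (hd : (2 <= d)%N) p x z : p != x -> edist p x <= 2 ->
  spindle p x z -> edist p z <= edist p x.
Proof.
move=> px px2 hz; have [e [l [h [e1 l0 h0 lh [hp hx]]]]] := spindle_frame px px2.
have l2 : edist p x = 2 * l.
  rewrite edistE {1}hp {2}hx (_ : _ - _ = - (2 * l) *: e); last by vring.
  by rewrite enormZ normrN ger0_norm ?mulr_ge0 ?ltW // /enorm e1 sqrtr1 mulr1.
have : bulge h e (z - mid p x) <= l ^+ 2.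
  rewrite leNgt; apply/negP => /(spindle_out_bulge hd hp hx e1 lh)[c [pc xc zc]].
  move: hz; rewrite spindleE // => /(_ c); rewrite pc xc => /(_ (lexx _) (lexx _)).
  by rewrite leNgt zc.
rewrite /bulge => hb.
have zm : edist (mid p x) z <= l.
  rewrite edistC edist_le ?(ltW l0) //; apply: le_trans hb.
  by rewrite lerDl !mulr_ge0 ?enorm_ge0.
have := edist_tri p (mid p x) z.
rewrite edist_midl l2; lra.
Qed.

(* By the law of sines, the last hypothesis says that the triangle p, x, z has
   circumradius at least 1. *)
Lemma spindle_circumradius p x z : p != x -> edist p x <= 2 ->
  dot (z - p) (z - x) <= 0 ->
  dot (z - x) (z - x) * dot (p - x) (p - x) * (4 - dot (z - p) (z - p))
    <= 4 * dot (z - x) (p - x) ^+ 2 ->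
  spindle p x z.
Proof.
move=> px px2; have [e [l [h [e1 l0 h0 lh [hp hx]]]]] := spindle_frame px px2.
move=> N0 P0; apply: (spindle_bulge hp hx px2 e1 (ltW l0) h0 lh).
set v := z - mid p x.
have zp : z - p = v + l *: e by rewrite {1}hp /v; vring.
have zx : z - x = v - l *: e by rewrite {1}hx /v; vring.
have pe : p - x = - (2 * l) *: e by rewrite {1}hp {2}hx; vring.
move: N0 P0; rewrite zp zx pe /bulge.
clearbody v; set b := enorm _; have b2 : b ^+ 2 = dot v v - dot v e ^+ 2.
  by rewrite enorm_sqr dot_perp // expr2.
have b0 : 0 <= b by exact: enorm_ge0.
rewrite !dotE (dotC e v) e1 => N0 P0.
(* By Thales z lies in the ball with diameter from p to x, so the right side of the next inequality
   is nonnegative and squaring is allowed. *)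
have {}N0 : dot v v <= l ^+ 2 by nra.
suff : 2 * h * b <= l ^+ 2 - dot v v by lra.
rewrite -(@ler_pXn2r _ 2) ?nnegrE ?mulr_ge0 ?subr_ge0 //.
have h2 : h ^+ 2 = 1 - l ^+ 2 by lra.
rewrite !exprMn b2 h2.
rewrite -subr_ge0 in P0; rewrite -subr_ge0.
(* Multiplied by [4 * l ^+ 2], the squared inequality is exactly the circumradius hypothesis. *)
have l4 : 0 < 4 * l ^+ 2 by nra.
rewrite -(pmulr_rge0 _ l4); apply: le_trans P0 _.
by rewrite le_eqVlt; apply/orP; left; apply/eqP; ring.
Qed.

End SpindleSets.

(** * Starshaped compact sets, dilations and the Hausdorff distance *)

Section Starshaped.
Variables (R : realType) (d : nat).
Implicit Types (m u v w x y z c p q : 'rV[R]_d) (a t r l h e : R) (A B S T : set 'rV[R]_d).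

Lemma spindleP p x z : edist p x <= 2 ->
  spindle p x z <-> forall c, edist p c <= 1 -> edist x c <= 1 -> edist z c <= 1.
Proof. by move=> px; rewrite spindleE. Qed.

Lemma spindle_refl p x : edist p x <= 2 -> spindle p x p /\ spindle p x x.
Proof. by move=> px; split; apply/spindleP. Qed.

(** Ensures that [spindle p q] is an intersection of balls and not the whole space. The unit ball
    about the midpoint contains p and x, hence q. *)
Lemma spindle_edist2 p x q : edist p x <= 2 -> spindle p x q -> edist p q <= 2.
Proof.
move=> px /(spindleP _ px)/(_ (mid p x)).
rewrite edist_midl edist_midr => h; have := edist_tri p (mid p x) q.
rewrite edist_midl (edistC (mid p x) q).
have px1 : edist p x / 2 <= 1 by lra.
have := h px1 px1; lra.
Qed.

(** The reason why attaching [spindle p x] to a set keeps [p] in the kernel. *)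
Lemma spindle_sub p x q : edist p x <= 2 -> spindle p x q ->
  spindle p q `<=` spindle p x.
Proof.
move=> px hq z /(spindleP _ (spindle_edist2 px hq)) hz.
apply/spindleP => // c pc xc; apply: hz => //.
by move/(spindleP _ px): hq; apply.
Qed.

Lemma spindle_compact p x : edist p x <= 2 -> compact (spindle p x).
Proof.
move=> px; apply: (@bounded_closed_edist_compact _ _ _ p 2); last first.
  by move=> q; exact: spindle_edist2.
apply/closed_edist => z hz; apply/spindleP => // c pc xc.
rewrite leNgt; apply/negP => zc.
have [|y /(spindleP _ px)/(_ c pc xc) yz] := hz (edist z c - 1); first by rewrite subr_gt0.
have := edist_tri z y c; lra.
Qed.

Lemma compact_closed_rV A : compact A -> closed A.
Proof. by apply: compact_closed; exact: norm_hausdorff. Qed.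

Lemma spindle_kernelP p A :
  spindle_kernel A p <-> A p /\ forall q, A q -> spindle p q `<=` A.
Proof.
split=> [[Ap h]|[Ap h]].
  by split=> // q; rewrite -{1}h => -[].
split=> //; apply/seteqP; split=> [q []//|q Aq]; split=> //; exact: h.
Qed.

Lemma compact_not_full A : (0 < d)%N -> compact A -> A != setT.
Proof.
move=> d0 /(compact_edist_bounded 0)[M M0 hM].
apply/eqP => AT.
pose v : 'rV[R]_d := (M + 1) *: delta_mx 0 (Ordinal d0).
have M1 : 0 <= M + 1 by rewrite addr_ge0 // ltW.
have := hM v; rewrite AT => /(_ I); rewrite edistE sub0r enormN enormZ ger0_norm //.
rewrite /enorm dot_delta mxE !eqxx sqrtr1; lra.
Qed.

(** Otherwise [spindle p q] would be the whole space, which is not compact for [0 < d]. *)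
Lemma kernel_edist p q A : (0 < d)%N -> compact A -> spindle_kernel A p -> A q ->
  edist p q <= 2.
Proof.
move=> d0 cA /spindle_kernelP[_ h] Aq; have := h q Aq; rewrite /spindle.
case: ifP => // _ TA; have /eqP[] := compact_not_full d0 cA.
by apply/seteqP; split.
Qed.

Lemma star_add_spindle p x A : compact A -> edist p x <= 2 -> A p ->
  (forall q, A q -> spindle p q `<=` A) ->
  [/\ compact (A `|` spindle p x), (A `|` spindle p x) p &
   forall q, (A `|` spindle p x) q -> spindle p q `<=` A `|` spindle p x].
Proof.
move=> cA px Ap h; split; [|by left|].
  by apply: compactU => //; exact: spindle_compact.
move=> q [Aq|xq] z pz; first by left; exact: (h q Aq).
by right; apply: spindle_sub pz.
Qed.

Lemma cSS_intro p A : compact A -> A p -> (forall q, A q -> spindle p q `<=` A) ->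
  cSS A.
Proof. by move=> cA Ap h; split => //; exists p; apply/spindle_kernelP. Qed.

Definition dilation p t z : 'rV[R]_d := p + t *: (z - p).

Lemma edist_dilation p t x y : 0 <= t ->
  edist (dilation p t x) (dilation p t y) = t * edist x y.
Proof.
move=> t0; rewrite !edistE -[t in RHS]ger0_norm // -enormZ; congr enorm.
by rewrite /dilation; vring.
Qed.

Lemma dilation_compact p t A : 0 < t -> compact A -> compact (dilation p t @` A).
Proof.
move=> t0 cA; apply: continuous_compact => //; apply: continuous_subspaceT => z U.
move=> /nbhs_edist[e e0 hU]; apply/nbhs_edist; exists (e / t); first exact: divr_gt0.
by move=> y zy; apply: hU; rewrite edist_dilation ?(ltW t0) // mulrC -ltr_pdivlMr.
Qed.

Lemma dilationVK p t z : t != 0 -> dilation p t (dilation p t^-1 z) = z.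
Proof. by move=> t0; apply/rowP => i; rewrite !mxE; field. Qed.

Lemma dilationp p t : dilation p t p = p.
Proof. by rewrite /dilation subrr scaler0 addr0. Qed.

(* A ball of radius t <= 1 is an intersection of unit balls, so the homothetic copy of
   the spindle, an intersection of balls of radius t, is spindle convex. *)
Lemma dilation_spindle p t s : 0 < t -> t <= 1 -> edist p s <= 2 ->
  spindle p (dilation p t s) `<=` dilation p t @` spindle p s.
Proof.
move=> t0 t1 ps z.
have pq : edist p (dilation p t s) <= 2.
  rewrite -{1}(dilationp p t) edist_dilation ?(ltW t0) //.
  have := edist_ge0 p s; nra.
move=> /(spindleP _ pq) hz.
exists (dilation p t^-1 z); last first.
  by rewrite dilationVK // gt_eqF.
apply/spindleP => // c pc sc; rewrite leNgt; apply/negP => zc.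
pose c0 := dilation p t c.
have zc0 : t < edist z c0.
  rewrite -[z](dilationVK p _ (lt0r_neq0 t0)).
  by rewrite edist_dilation ?(ltW t0) // ltr_pMr.
pose r := edist z c0.
have r0 : 0 < r by apply: lt_trans zc0.
(* The centre moves away from [z] by 1 - t: the unit ball about [c1] contains the ball of radius t
   about [c0], but [z] is at distance r + (1 - t) > 1. *)
pose c1 := c0 - ((1 - t) / r) *: (z - c0).
have rt : 0 <= (1 - t) / r by rewrite divr_ge0 ?(ltW r0) // subr_ge0.
have c01 : edist c0 c1 = 1 - t.
  rewrite edistE /c1 opprB addrC subrK enormZ -edistE ger0_norm // -/r.
  by rewrite divfK // gt_eqF.
have zc1 : edist z c1 = r + (1 - t).
  rewrite edistE (_ : z - c1 = (1 + (1 - t) / r) *: (z - c0)); last by rewrite /c1; vring.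
  rewrite enormZ -edistE ger0_norm ?addr_ge0 // -/r mulrDl mul1r divfK //.
  by rewrite gt_eqF.
have pc1 : edist p c1 <= 1.
  apply: le_trans (edist_tri _ c0 _) _; rewrite c01 -{1}(dilationp p t).
  rewrite edist_dilation ?(ltW t0) //; nra.
have qc1 : edist (dilation p t s) c1 <= 1.
  apply: le_trans (edist_tri _ c0 _) _; rewrite c01.
  rewrite edist_dilation ?(ltW t0) //; nra.
have := hz c1 pc1 qc1; rewrite zc1 -/r in zc0 *; lra.
Qed.

Lemma dilation_star p t A : (0 < d)%N -> 0 < t -> t <= 1 ->
  compact A -> spindle_kernel A p ->
  forall q, (dilation p t @` A) q -> spindle p q `<=` dilation p t @` A.
Proof.
move=> d0 t0 t1 cA kp _ [s As <-] z hz; have ps := kernel_edist d0 cA kp As.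
have /spindle_kernelP[_ h] := kp.
by have [y sy <-] := dilation_spindle t0 t1 ps hz; exists y => //; exact: h sy.
Qed.

(** Boundedness makes the set of admissible radii nonempty, so [inf] is a true infimum and not its
    default value, and some admissible radius is below [e]. *)
Lemma hausdorff_lt A B e : compact A -> compact B -> A !=set0 -> B !=set0 ->
  hausdorff A B < e ->
  (forall x, A x -> exists2 y, B y & edist x y < e) /\
  (forall x, B x -> exists2 y, A y & edist x y < e).
Proof.
move=> cA cB [a0 Aa0] [b0 Bb0] hAB.
have [MA MA0 hA] := compact_edist_bounded b0 cA.
have [MB MB0 hB] := compact_edist_bounded a0 cB.
set E := [set e : R | 0 <= e /\ A `<=` eneigh B e /\ B `<=` eneigh A e].
have hE : has_inf E.
  split; last by exists 0 => x [].
  exists (MA + MB); split; first by rewrite addr_ge0 ?ltW.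
  split=> x hx; [exists b0 => //|exists a0 => //]; rewrite edistC.
    by rewrite (le_trans (hA _ hx)) // lerDl ltW.
  by rewrite (le_trans (hB _ hx)) // lerDr ltW.
have eH : 0 < e - hausdorff A B by rewrite subr_gt0.
have [r [r0 [hAr hBr]] re] := inf_adherent eH hE.
have {}re : r < e by apply: lt_le_trans re _; rewrite subrKC.
split=> x hx.
  by have [y By xy] := hAr x hx; exists y => //; exact: le_lt_trans re.
by have [y By xy] := hBr x hx; exists y => //; exact: le_lt_trans re.
Qed.

Lemma hausdorff_le A B e : 0 <= e -> 
  (forall x, A x -> exists2 y, B y & edist x y <= e) ->
  (forall x, B x -> exists2 y, A y & edist x y <= e) -> hausdorff A B <= e.
Proof. by move=> e0 hA hB; apply: ge_inf => //; exists 0 => x []. Qed.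

End Starshaped.

(** * Limits of kernel points *)

Section LimitKernel.
Variables (R : realType) (d : nat).
Implicit Types (m u v w x y z c p q : 'rV[R]_d) (a t r l h e : R) (A B S T : set 'rV[R]_d).

(** The conditions of [spindle_circumradius], made strict, are open in the pair of end points; [F3]
    keeps these distinct. *)
Lemma spindle_perturb q x z : q != x -> dot (z - q) (z - x) < 0 ->
  dot (z - x) (z - x) * dot (q - x) (q - x) * (4 - dot (z - q) (z - q))
    < 4 * dot (z - x) (q - x) ^+ 2 ->
  exists2 e, 0 < e & forall q' x', edist q q' < e -> edist x x' < e ->
    edist q' x' <= 2 -> spindle q' x' z.
Proof.
move=> qx N0 P0.
pose F1 (w : 'rV[R]_d * 'rV[R]_d) := dot (z - w.1) (z - w.2).
pose F2 (w : 'rV[R]_d * 'rV[R]_d) := 4 * (dot (z - w.2) (w.1 - w.2) * dot (z - w.2) (w.1 - w.2)) -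
  dot (z - w.2) (z - w.2) * dot (w.1 - w.2) (w.1 - w.2) * (4 - dot (z - w.1) (z - w.1)).
pose F3 (w : 'rV[R]_d * 'rV[R]_d) := dot (w.1 - w.2) (w.1 - w.2).
have c1 : (z - w.1) @[w --> (q, x)] --> z - q.
  exact: (@cvgB R _ _ (nbhs (q, x)) _ (fun=> z) fst z q (cvg_cst z) cvg_fst).
have c2 : (z - w.2) @[w --> (q, x)] --> z - x.
  exact: (@cvgB R _ _ (nbhs (q, x)) _ (fun=> z) snd z x (cvg_cst z) cvg_snd).
have c3 : (w.1 - w.2) @[w --> (q, x)] --> q - x.
  exact: (@cvgB R _ _ (nbhs (q, x)) _ fst snd q x cvg_fst cvg_snd).
have n1 : \forall w \near (q, x), F1 w < 0.
  exact: (cvg_dot c1 c2 (lt_nbhsl N0)).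
have n3 : \forall w \near (q, x), 0 < F3 w.
  have qx0 : 0 < dot (q - x) (q - x) by rewrite dot_gt0 // subr_eq0.
  exact: (cvg_dot c3 c3 (lt_nbhsr qx0)).
have n2 : \forall w \near (q, x), 0 < F2 w.
  have : F2 w @[w --> (q, x)] --> F2 (q, x).
    have d11 := cvg_dot c1 c1; have d22 := cvg_dot c2 c2.
    have d23 := cvg_dot c2 c3; have d33 := cvg_dot c3 c3.
    exact: (cvgB (cvgM (cvg_cst (4 : R)) (cvgM d23 d23))
      (cvgM (cvgM d22 d33) (cvgB (cvg_cst (4 : R)) d11))).
  have F20 : 0 < F2 (q, x) by rewrite /F2 subr_gt0.
  by move=> /(_ _ (lt_nbhsr F20)).
have [[U V] /= [/nbhs_edist[e1 e10 h1] /nbhs_edist[e2 e20 h2]] UV] :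
  nbhs (q, x) [set w | [/\ F1 w < 0, 0 < F2 w & 0 < F3 w]].
  by near=> w; split; near: w.
exists (Num.min e1 e2); first by rewrite lt_min e10.
move=> q' x'; rewrite !lt_min => /andP[/h1 Uq _] /andP[_ /h2 Vx] qx'.
have [f1 f2 f3] := UV (q', x') (conj Uq Vx).
apply: spindle_circumradius => //.
- by apply: contraTneq f3 => ->; rewrite /F3 /= subrr dot0r ltxx.
- exact: ltW.
- by rewrite -subr_ge0 ltW.
Unshelve. all: by end_near. Qed.

(** The upper limit of the kernels of members of [cSS] tending to [T]. *)
Definition limit_kernel T q := forall e, 0 < e -> exists S q',
  [/\ cSS S, spindle_kernel S q', edist q q' < e & hausdorff T S < e].

Lemma closed_sep A x : closed A -> ~ A x -> exists2 e, 0 < e & forall y, A y -> e <= edist x y.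
Proof.
move=> /closed_edist cA nAx; apply: contrapT => h; apply: nAx; apply: cA => e e0.
apply: contrapT => h'; apply: h; exists e => // y Ay.
by rewrite leNgt; apply/negP => xy; apply: h'; exists y.
Qed.

(** The point x' is taken in a set S close to T having q' in its kernel, so the spindle from q' to
    x' lies in S. *)
Lemma limit_kernel_near T q x e : (0 < d)%N -> compact T -> limit_kernel T q -> T x -> 0 < e ->
  exists q' x', [/\ edist q q' < e, edist x x' < e, edist q' x' <= 2 &
    forall z, spindle q' x' z -> exists2 y, T y & edist z y < e].
Proof.
move=> d0 cT lk Tx e0; have [S [q' [[cS _] kq qq' TS]]] := lk _ e0.
have /spindle_kernelP[Sq hS] := kq.
have [hTS hST] := hausdorff_lt cT cS (ex_intro _ _ Tx) (ex_intro _ _ Sq) TS.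
have [x' Sx xx'] := hTS x Tx; exists q', x'; split=> //.
  exact: kernel_edist kq Sx.
by move=> z /(hS x' Sx)/hST.
Qed.

(* If q is outside the spindle, some unit ball, centred at c, has p and x on its boundary
   but misses q. The direction q - x, made orthogonal to c - x when it points into the
   ball, leaves the ball at x, yet initially stays inside the spindle of q and x. *)
Lemma limit_kernel_tip (hd : (2 <= d)%N) A p x q : edist p x <= 2 ->
  compact A -> A p -> ~ A x ->
  limit_kernel (A `|` spindle p x) q -> spindle p x q.
Proof.
move=> px2 cA Ap nAx; set T := A `|` _ => lk.
have d0 : (0 < d)%N by exact: ltnW.
have px : p != x by apply: contra_notN nAx => /eqP <-.
have cT : compact T by apply: compactU => //; exact: spindle_compact.
have [_ xx] := spindle_refl px2.
have Tx : T x by right.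
(* Kernel points are within 2 of every point of their set, and this bound passes to the limit. *)
have qx2 : edist q x <= 2.
  rewrite leNgt; apply/negP => qx.
  have e0 : 0 < (edist q x - 2) / 2 by rewrite divr_gt0 // subr_gt0.
  have [q' [x' [qq' xx' q'x' _]]] := limit_kernel_near d0 cT lk Tx e0.
  have := edist_tri q q' x; have := edist_tri q' x' x; rewrite (edistC x'); lra.
apply: contrapT => nq.
have qx : q != x by apply: contra_notN nq => /eqP ->.
have [c [pc xc qc]] := spindle_out hd px px2 nq.
have [y hy] : exists y, y = q - x by exists (q - x).
have [n hn] : exists n, n = c - x by exists (c - x).
have n1 : dot n n = 1 by rewrite hn -enorm_sqr -edistE edistC xc expr1n.
have y4 : dot y y <= 4 by move: qx2; rewrite edist_le // -hy; lra.
have y0 : 0 < dot y y by rewrite dot_gt0 // hy subr_eq0.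
have yn : 2 * dot y n < dot y y.
  have : 1 < dot (q - c) (q - c) by rewrite ltNge -edist_le1 -ltNge.
  rewrite (_ : q - c = y - n); last by rewrite hy hn; vring.
  rewrite dot_sub n1; lra.
(* The positive part covers both cases: [v] below is [y] itself if [dot y n <= 0], and otherwise the
   projection of [y] orthogonal to [n]. *)
pose a := Num.max (dot y n) 0.
have a0 : 0 <= a by rewrite le_max lexx orbT.
have ay : 2 * a < dot y y by rewrite /a; case: (leP (dot y n) 0) => _ //; rewrite mulr0.
have yna : dot y n <= a by rewrite le_max lexx.
have aa : a * dot y n = a ^+ 2.
  by rewrite /a; case: (leP (dot y n) 0) => _; rewrite ?mul0r ?expr0n ?expr2.
clearbody a.
have [v hv] : exists v, v = y - a *: n by exists (y - a *: n).
pose V := dot y y - a ^+ 2.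
have vv : dot v v = V by rewrite hv dot_sub !dotE n1 /V; lra.
have vy : dot v y = V by rewrite hv !dotE (dotC n y) /V; lra.
have vn : dot v n <= 0 by rewrite hv !dotE n1; lra.
have V0 : 0 < V by rewrite /V; nra.
(* The value at t = 0 of the factor [W] below, which decides the circumradius inequality. It is
   positive because 2 a < y.y, that is, because q is outside the ball about c. *)
pose K := dot y y ^+ 2 - 4 * a ^+ 2.
have K0 : 0 < K by rewrite /K; nra.
have [e0 e00 hA] := closed_sep (compact_closed_rV cA) nAx.
have ev0 : 0 < enorm v by rewrite sqrtr_gt0 vv.
(* The bound 1 makes the angle at [z] obtuse, the one with [K] makes the circumradius exceed 1, and
   the last keeps [z] out of [A]. *)
have [t [t0 t1 tK te]] : exists t, [/\ 0 < t, t < 1, 2 * t * (V * dot y y) < K & t * enorm v < e0].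
  have Vy : 0 < 2 * (V * dot y y) by rewrite !mulr_gt0.
  pose s := Num.min 1 (Num.min (K / (2 * (V * dot y y))) (e0 / enorm v)).
  have s0 : 0 < s by rewrite !lt_min ltr01 !divr_gt0.
  have s1 : s / 2 < s by rewrite ltr_pdivrMr // ltr_pMr // ltr1n.
  exists (s / 2); split; first by rewrite divr_gt0.
  - by apply: lt_le_trans s1 _; rewrite ge_min lexx.
  - rewrite -mulrA mulrCA -ltr_pdivlMr //.
    by apply: lt_le_trans s1 _; rewrite !ge_min lexx orbT.
  - rewrite -ltr_pdivlMr //.
    by apply: lt_le_trans s1 _; rewrite !ge_min lexx !orbT.
pose z := x + t *: v.
have zx : z - x = t *: v by rewrite /z addrC addKr.
have zq : z - q = t *: v - y by rewrite /z hy; vring.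
have zcn : z - c = t *: v - n by rewrite /z hn; vring.
(* Since v.n <= 0, the point [z] is farther than 1 from [c], hence outside the spindle of p and
   x. *)
have nTz : ~ T z.
  case=> [/hA|].
    by rewrite edistC edistE zx enormZ gtr0_norm // leNgt te.
  move=> /(spindleP _ px2)/(_ c); rewrite pc xc => /(_ (lexx _) (lexx _)).
  rewrite edist_le1 zcn dot_sub !dotE n1 vv leNgt => /negP; apply.
  have : 0 < t * (t * V) by rewrite !mulr_gt0.
  have : t * dot v n <= 0 by rewrite mulr_ge0_le0 // ltW.
  lra.
have [e1 e10 hT] := closed_sep (compact_closed_rV cT) nTz.
have [||e2 e20 hz] := @spindle_perturb q x z qx.
- by rewrite zq zx !dotE vv (dotC y) vy pmulr_rlt0 // subr_lt0 gtr_pMl.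
- rewrite zq zx -hy dot_sub !dotE vv vy.
  rewrite -subr_gt0.
  pose W := K - 2 * t * (V * dot y y) + t ^+ 2 * (V * dot y y).
  have W0 : 0 < W.
    by rewrite addr_gt0 ?subr_gt0 // !mulr_gt0 // exprn_gt0.
  have : 0 < t ^+ 2 * V * W by rewrite !mulr_gt0 // exprn_gt0.
  by congr (0 < _); rewrite /W /K /V; ring.
have e0' : 0 < Num.min e1 e2 by rewrite lt_min e10.
have [q' [x' [qq' xx' q'x' hS]]] := limit_kernel_near d0 cT lk Tx e0'.
move: qq' xx'; rewrite !lt_min => /andP[_ qq'] /andP[_ xx'].
have [s Ts] := hS z (hz q' x' qq' xx' q'x').
by rewrite lt_min ltNge (hT s Ts).
Qed.

End LimitKernel.

(** * Approximation by sets with small limit kernel *)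

Section Approximation.
Variables (R : realType) (d : nat).
Implicit Types (m u v w x y z c p q : 'rV[R]_d) (a t r l h e : R) (A B S T : set 'rV[R]_d).

Lemma closed_ball_compact p r : compact [set z | edist p z <= r].
Proof.
apply: (@bounded_closed_edist_compact _ _ _ p r) => //.
apply/closed_edist => x hx; rewrite /= leNgt; apply/negP => px.
have [|y /= yr xy] := hx (edist p x - r); first by rewrite subr_gt0.
have := edist_tri p y x; rewrite (edistC y); lra.
Qed.

(** Kernel points of sets within 1/(k+1) of the compact [T] form a bounded sequence; its cluster
    points are limit kernel points and keep the distance from [p]. *)
Lemma limit_kernel_exists T p r : compact T -> T !=set0 ->
  (forall e, 0 < e -> exists S q,
    [/\ cSS S, spindle_kernel S q, hausdorff T S < e & r <= edist p q]) ->
  exists2 q, limit_kernel T q & r <= edist p q.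
Proof.
move=> cT T0 h.
have /choice[f hf] : forall k : nat, exists Sq : set 'rV[R]_d * 'rV[R]_d,
    [/\ cSS Sq.1, spindle_kernel Sq.1 Sq.2, hausdorff T Sq.1 < k.+1%:R^-1
      & r <= edist p Sq.2].
  move=> k; have [|S [q hq]] := h k.+1%:R^-1; first by rewrite invr_gt0.
  by exists (S, q).
have [M M0 hM] := compact_edist_bounded p cT.
pose u k := (f k).2.
have uM k : edist p (u k) <= M + 1.
  have [[cS _] /spindle_kernelP[Sq _] TS _] := hf k.
  have [_ /(_ _ Sq)[y Ty qy]] := hausdorff_lt cT cS T0 (ex_intro _ _ Sq) TS.
  have := edist_tri p y (f k).2; have := hM y Ty; rewrite (edistC y (f k).2).
  have : edist (f k).2 y < 1 by apply: lt_le_trans qy _; rewrite invf_le1 // ler1n.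
  rewrite /u; lra.
have [|q [_ cq]] := @closed_ball_compact p (M + 1) (u @ \oo) _.
  by exists 0%N => // k _; exact: uM.
have freq e N : 0 < e -> exists2 k, (N <= k)%N & edist q (u k) < e.
  move=> e0; have [||x [[k Nk <-] xq]] := cq (u @` [set k | (N <= k)%N]) [set x | edist q x < e].
  - by exists N => // k Nk; exists k.
  - by apply/nbhs_edist; exists e.
  by exists k.
exists q.
  move=> e e0; have [N _ hN] := near_infty_natSinv_lt (PosNum e0).
  have [k Nk qk] := freq e N e0; have [cS kq TS _] := hf k.
  exists (f k).1, (u k); split => //; apply: lt_trans TS _.
  exact: (hN k Nk).
rewrite leNgt; apply/negP => qr.
have [|k _ qk] := freq (r - edist p q) 0%N; first by rewrite subr_gt0.
have [_ _ _ hr] := hf k; have := edist_tri p q (u k); rewrite -/(u k) in hr; lra.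
Qed.

Lemma ray_edist p u a t : dot u u = 1 -> edist (p + a *: u) (p + t *: u) = `|a - t|.
Proof.
move=> u1; rewrite edistE (_ : _ - _ = (a - t) *: u); last by vring.
by rewrite enormZ /enorm u1 sqrtr1 mulr1.
Qed.

Lemma ray_edist0 p u t : dot u u = 1 -> edist p (p + t *: u) = `|t|.
Proof.
by move=> u1; rewrite -{1}[p]addr0 -(scale0r u) ray_edist // sub0r normrN.
Qed.

(** For t in [0, 2] the unit ball about p + u contains both ends of the spindle. *)
Lemma ray_spindle p u t z : dot u u = 1 -> 0 <= t -> t <= 2 ->
  spindle p (p + t *: u) z -> edist z (p + u) <= 1.
Proof.
move=> u1 t0 t2; have px : edist p (p + t *: u) <= 2 by rewrite ray_edist0 // ger0_norm.
move=> /(spindleP _ px)/(_ (p + u)); rewrite -[in p + u](scale1r u).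
rewrite ray_edist0 // ray_edist // normr1; apply => //.
by rewrite ler_norml; apply/andP; split; lra.
Qed.

(** Choose a parameter of the ray exceeding t times the supremum of those in S. Were its point the
    dilation of some s in S, then s would lie on the ray at a / t, beyond the supremum. *)
Lemma ray_exit p u t e S : compact S -> dot u u = 1 -> 0 < t -> t < 1 -> 0 < e ->
  (forall x, edist p x < e -> S x) ->
  exists2 a, 0 < a & S (p + a *: u) /\ ~ (dilation p t @` S) (p + a *: u).
Proof.
move=> cS u1 t0 t1 e0 hS; have [M M0 hM] := compact_edist_bounded p cS.
pose E := [set a | S (p + a *: u)].
have Ee : E (e / 2).
  by apply: hS; rewrite ray_edist0 // ger0_norm; lra.
have hE : has_sup E.
  split; [by exists (e / 2)|exists M => a /hM]; rewrite ray_edist0 //.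
  by apply: le_trans; exact: ler_norm.
have E0 : 0 < sup E.
  by apply: (@lt_le_trans _ _ (e / 2)); [lra|exact: sup_upper_bound].
have [|a Ea sa] := @sup_adherent _ E ((1 - t) * sup E) _ hE.
  by rewrite mulr_gt0 // subr_gt0.
have {}sa : t * sup E < a by apply: le_lt_trans sa; lra.
have a0 : 0 < a by apply: le_lt_trans sa; rewrite mulr_ge0 // ltW.
exists a => //; split=> // -[s Ss sE].
have : E (a / t).
  rewrite /E /= (_ : p + (a / t) *: u = s) //.
  apply/rowP => i; move/rowP/(_ i): sE; rewrite !mxE => sE.
  rewrite mulrAC; apply/eqP; rewrite -subr_eq0.
  have -> : p 0 i + a * u 0 i / t - s 0 i = (p 0 i + a * u 0 i - (p 0 i + t * (s 0 i - p 0 i))) / t.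
    by field; rewrite gt_eqF.
  by rewrite sE subrr mul0r.
move=> /(sup_upper_bound hE); rewrite ler_pdivrMr // mulrC; lra.
Qed.

(** The attached spindle lies in the ball about p through x, so it changes S by at most [edist p x],
    and it contains every limit kernel point. *)
Lemma approx_isolated (hd : (2 <= d)%N) S p x e : cSS S -> spindle_kernel S p ->
  edist p x < e -> edist p x <= 2 -> ~ S x ->
  exists2 T, cSS T & hausdorff S T < e /\
    forall q, limit_kernel T q -> edist p q <= e.
Proof.
move=> [cS _] /spindle_kernelP[Sp hS] pxe px2 nSx.
have px : p != x by apply: contra_notN nSx => /eqP <-.
have [cT Tp hT] := star_add_spindle cS px2 Sp hS.
exists (S `|` spindle p x); first exact: cSS_intro hT.
split=> [|q /(limit_kernel_tip hd px2 cS Sp nSx) hq].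
  apply: le_lt_trans pxe; apply: hausdorff_le; first exact: edist_ge0.
    by move=> y Sy; exists y; rewrite ?edistxx ?edist_ge0 //; left.
  move=> y [Sy|xy]; first by exists y; rewrite ?edistxx ?edist_ge0.
  by exists p => //; rewrite edistC; exact: spindle_edist xy.
by apply: le_trans (ltW pxe); exact: spindle_edist hq.
Qed.

Lemma approx_interior (hd : (2 <= d)%N) S p r e : cSS S -> spindle_kernel S p ->
  0 < e -> (forall x, edist p x < e -> S x) -> 0 < r ->
  exists2 T, cSS T & hausdorff S T < r /\
    forall q, limit_kernel T q -> q = p.
Proof.
move=> [cS _] kp e0 hS r0; have d0 : (0 < d)%N by exact: ltnW.
have /spindle_kernelP[Sp hSp] := kp.
pose u : 'rV[R]_d := delta_mx 0 (Ordinal d0).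
have u1 : dot u u = 1 by rewrite dot_delta mxE !eqxx.
have u1' : dot (- u) (- u) = 1 by rewrite dotNN.
pose s := Num.min 1 (r / 2).
have s0 : 0 < s by rewrite lt_min ltr01 divr_gt0.
have [s1 sr] : s <= 1 /\ s <= r / 2 by rewrite !ge_min !lexx orbT.
clearbody s.
(* Points of S are within 2 of p, so this dilation moves them by at most s. *)
pose t := 1 - s / 2; have [t0 t1] : 0 < t /\ t < 1 by rewrite /t; split; lra.
pose D := dilation p t @` S.
have [a a0 [Sx nDx]] := ray_exit cS u1 t0 t1 e0 hS.
have [b b0 [Sy nDy]] := ray_exit cS u1' t0 t1 e0 hS.
set x := p + a *: u in Sx nDx; set y := p + b *: - u in Sy nDy.
have px := kernel_edist d0 cS kp Sx; have py := kernel_edist d0 cS kp Sy.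
have a2 : a <= 2 by move: px; rewrite ray_edist0 // gtr0_norm.
have b2 : b <= 2 by move: py; rewrite ray_edist0 // gtr0_norm.
have cD : compact D by exact: dilation_compact.
have Dp : D p by exists p => //; rewrite dilationp.
have hD := dilation_star d0 t0 (ltW t1) cS kp.
have hx z : spindle p x z -> edist z (p + u) <= 1 by apply: ray_spindle => //; exact: ltW.
have hy z : spindle p y z -> edist z (p - u) <= 1 by apply: ray_spindle => //; exact: ltW.
(* The points y and p + u are 1 + b apart. With the symmetric fact, each tip is missing from the
   rest of the set, as [limit_kernel_tip] requires. *)
have nxy : ~ spindle p x y.
  move=> /hx; rewrite /y scalerN -scaleNr -[in p + u](scale1r u) ray_edist //.
  by rewrite -opprD normrN gtr0_norm ?addr_gt0 //; lra.
have nyx : ~ spindle p y x.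
  move=> /hy; rewrite /x -scaleN1r ray_edist // opprK gtr0_norm ?addr_gt0 //; lra.
have [cDx Dxp hDx] := star_add_spindle cD px Dp hD.
have [cDy Dyp hDy] := star_add_spindle cD py Dp hD.
have [cT Tp hT] := star_add_spindle cDx py Dxp hDx.
exists (D `|` spindle p x `|` spindle p y); first exact: cSS_intro hT.
have hds z : S z -> edist z (dilation p t z) <= s.
  move=> Sz; rewrite edistE (_ : z - dilation p t z = (s / 2) *: (z - p)); last first.
    by rewrite /dilation /t; vring.
  rewrite enormZ -edistE edistC ger0_norm; last lra.
  have := kernel_edist d0 cS kp Sz; have := edist_ge0 p z; nra.
split=> [|q lq].
  apply: (@le_lt_trans _ _ s); last lra.
  apply: hausdorff_le; first exact: ltW.
    by move=> z Sz; exists (dilation p t z); [left; left; exists z|exact: hds].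
  move=> z [[[w Sw <-]|xz]|yz].
  - by exists w => //; rewrite edistC; exact: hds.
  - by exists z; [exact: hSp xz|rewrite edistxx ltW].
  - by exists z; [exact: hSp yz|rewrite edistxx ltW].
have /hy : spindle p y q.
  by apply: limit_kernel_tip lq => //; case.
have /hx : spindle p x q.
  (* Reorders the union so that the spindle of [x] is the one attached last. *)
  move: lq; rewrite setUAC => lq.
  by apply: limit_kernel_tip lq => //; case.
(* The unit balls about p + u and p - u touch only at p: adding their inequalities leaves |q - p|^2
   <= 0. *)
rewrite !edist_le1 (_ : q - (p + u) = q - p - u); last by vring.
rewrite (_ : q - (p - u) = q - p + u); last by vring.
rewrite dot_sub [X in _ -> X <= _ -> _](_ : _ =
  dot (q - p) (q - p) + 2 * dot (q - p) u + dot u u); last first.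
  by move: (q - p) => v; rewrite !dotE (dotC u); ring.
rewrite u1 => h1 h2.
have qp : dot (q - p) (q - p) = 0 by have := dot_ge0 (q - p); lra.
by apply/eqP; rewrite -subr_eq0; apply/eqP; exact: dot_eq0.
Qed.

Lemma approx_small_kernel (hd : (2 <= d)%N) S r e : cSS S -> 0 < r -> 0 < e ->
  exists T p, [/\ cSS T, hausdorff S T < r &
    forall q, limit_kernel T q -> edist p q <= e].
Proof.
move=> hS r0 e0; have [_ [p kp]] := hS.
(* The bound 1 keeps a missing point within distance 2 of p, where spindles are compact. *)
pose s := Num.min 1 (Num.min r e).
have s0 : 0 < s by rewrite !lt_min ltr01 r0.
have [s1 sr se] : [/\ s <= 1, s <= r & s <= e] by rewrite !ge_min !lexx !orbT.
have [[x [px nSx]]|h] := pselect (exists x, edist p x < s /\ ~ S x).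
  have [|T cT [ST hT]] := approx_isolated hd hS kp px _ nSx; first lra.
  exists T, p; split=> //; first exact: lt_le_trans sr.
  by move=> q /hT/le_trans; apply.
have [|T cT [ST hT]] := @approx_interior hd S p r s hS kp s0 _ r0.
  by move=> x px; apply: contrapT => nSx; apply: h; exists x.
by exists T, p; split=> // q /hT ->; rewrite edistxx ltW.
Qed.

End Approximation.

(** * The exceptional family as a countable union of nowhere dense sets *)

Theorem theorem3 (R : realType) (d : nat) (hd : (2 <= d)%N) :
  first_category_in (@cSS R d)
    [set S | cSS S /\ ~ exists p : 'rV[R]_d, spindle_kernel S = [set p]].
Proof.
exists (fun n => [set S | cSS S /\ exists p q,
  [/\ spindle_kernel S p, spindle_kernel S q & n.+1%:R^-1 <= edist p q]]).
split=> [n|].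
  split; first by move=> S [].
  apply/seteqP; split=> // S [[cS _] [r r0 hr]].
  have n0 : 0 < n.+1%:R^-1 :> R by rewrite invr_gt0.
  (* Of two kernel points 1/(n+1) apart, one is at least half that far from [p], and so is some
     limit kernel point; the bound by a quarter contradicts this. *)
  have [|T [p [cT ST hT]]] := approx_small_kernel hd cS r0 (e := n.+1%:R^-1 / 4).
    by rewrite divr_gt0.
  (* [T] lies in a ball contained in the closure, so members of the n-th set come arbitrarily close
     to it. *)
  have [_ hcl] := hr T cT ST.
  have [] := @limit_kernel_exists R d T p (n.+1%:R^-1 / 2).
  - by case: cT.
  - by case: cT => _ [q /spindle_kernelP[Tq _]]; exists q.
  - move=> e e0; have [S' [cS' [x [y [kx ky xy]]]] TS'] := hcl e e0.
    have [px|px] := leP (n.+1%:R^-1 / 2) (edist p x); first by exists S', x.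
    exists S', y; split=> //; have := edist_tri x p y; rewrite (edistC x p).
    by move: px xy; move: (n.+1%:R^-1) => a; lra.
  by move=> q /hT; move: (n.+1%:R^-1) n0 => a; lra.
apply/seteqP; split=> [S [cS hS]|S [n _ [cS [p [q [kp kq pq]]]]]].
  have [_ [p kp]] := cS.
  have [q [kq qp]] : exists q, spindle_kernel S q /\ p != q.
    apply: contrapT => h; apply: hS; exists p; apply/seteqP; split=> [q kq|_ ->//].
    by apply: contrapT => /eqP qp; apply: h; exists q; split=> //; rewrite eq_sym.
  have pq := edist_gt0 qp; have [n _ hn] := near_infty_natSinv_lt (PosNum pq).
  exists n => //; split=> //; exists p, q; split=> //.
  exact: ltW (hn n (leqnn n)).
split=> // -[x kx]; move: pq.
have -> : p = x by move: kp; rewrite kx.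
have -> : q = x by move: kq; rewrite kx.
by rewrite edistxx leNgt invr_gt0 ltr0n.
Qed.
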